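(* Let $y\in\mathbb{R}^m$, let $H:\mathbb{R}^n\to\mathbb{R}^m$ be a linear operator (matrix), and let $\sigma_m$ and $\sigma_M$ denote the least and greatest eigenvalues of $H^TH$. Suppose $P$ is lower semi-continuous and $\rho$-weakly convex with $0\le\rho\le\sigma_m$, and suppose the set of minimizers of $C(x)=\frac12\|y-Hx\|_2^2+P(x)$ is non-empty. If $0<\alpha<2/(\sigma_M+\rho)$, then for any starting point $x^0\in\mathbb{R}^n$ the sequence defined by $$x^{k+1}=T_\alpha\bigl(x^k+\alpha H^T(y-Hx^k)\bigr),\qquad k\ge 0,$$ converges to a minimizer of $C$.
   Context: A function $f:\mathbb{R}^n\to\mathbb{R}$ is $\rho$-weakly convex (with $\rho\ge 0$) if $x\mapsto \frac{s}{2}\|x\|_2^2+f(x)$ is convex whenever $s\ge\rho$. For $\alpha>0$, the threshold operator associated with $P$ is $T_\alpha(z)=\arg\min_{x}\ \frac{1}{2\alpha}\|x-z\|_2^2+P(x)$; it is well-defined (unique minimizer) when this minimization problem is strictly convex, which is the case here since $\alpha\rho<1$. *)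

(* Defs.v *)
From HB Require Import structures.
From mathcomp Require Import all_boot all_order all_algebra.
From mathcomp Require Import all_classical all_reals all_analysis.

Set Implicit Arguments.
Unset Strict Implicit.
Unset Printing Implicit Defensive.

Import Order.TTheory GRing.Theory Num.Theory.
Import numFieldNormedType.Exports.

Local Open Scope classical_set_scope.
Local Open Scope ring_scope.

(* The norm `|x| of the library is the sup norm on matrices. *)
Definition norm2 (R : realType) (n : nat) (x : 'cV[R]_n) : R :=
  Num.sqrt (\sum_(i < n) x i 0 ^+ 2).

Definition weakly_convex (R : realType) (n : nat) (rho : R)
    (f : 'cV[R]_n -> R) : Prop :=
  forall s : R, rho <= s ->
    convex_function [set: convex_lmodType 'cV[R]_n]
      (fun x : 'cV[R]_n => s / 2 * norm2 x ^+ 2 + f x).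

Definition minimizers (T : Type) (R : realType) (f : T -> R) : set T :=
  [set x | forall z, f x <= f z].

(* A choice of minimizer, hence the minimizer whenever it exists and is unique;
   the value 0 is used only if there is none. *)
Definition threshold (R : realType) (n : nat) (alpha : R) (P : 'cV[R]_n -> R)
    (z : 'cV[R]_n) : 'cV[R]_n :=
  xget 0 (minimizers (fun x => 1 / (2 * alpha) * norm2 (x - z) ^+ 2 + P x)).

Definition cost (R : realType) (m n : nat) (y : 'cV[R]_m) (H : 'M[R]_(m, n))
    (P : 'cV[R]_n -> R) (x : 'cV[R]_n) : R :=
  1 / 2 * norm2 (y - H *m x) ^+ 2 + P x.

(* [eigenvalue] refers to row eigenvectors, over R; for the symmetric matrices
   considered here these are all the eigenvalues. *)
Definition least_eigenvalue (R : realType) (n : nat) (A : 'M[R]_n) (s : R) :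
    Prop :=
  eigenvalue A s /\ forall a : R, eigenvalue A a -> s <= a.

Definition greatest_eigenvalue (R : realType) (n : nat) (A : 'M[R]_n) (s : R) :
    Prop :=
  eigenvalue A s /\ forall a : R, eigenvalue A a -> a <= s.

(* Main.v *)
Require Import Defs.
From HB Require Import structures.
From mathcomp Require Import all_boot all_order all_algebra.
From mathcomp Require Import all_classical all_reals all_analysis.
From mathcomp Require Import ring lra.

Set Implicit Arguments.
Unset Strict Implicit.
Unset Printing Implicit Defensive.

Import Order.TTheory GRing.Theory Num.Theory.
Import numFieldNormedType.Exports.

Local Open Scope classical_set_scope.
Local Open Scope ring_scope.

(** The proof rests on one inequality per iterate and on compactness.

    For a [rho]-weakly convex [P], call [g] a subgradient at [x] if
      P u >= P x + <g, u - x> - rho/2 |u - x|^2   for all u.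
    A minimizer of a penalized least-squares function [c |b - A u|^2 + P u]
    has the negative gradient of its smooth part as such a subgradient
    ([argmin_subgradient]).  Applied to [cost], this says that a minimizer [s]
    of the cost has the subgradient [H^T (y - H s)]; conversely a point with
    this subgradient is a minimizer, because [rho <= sigma_m] lets the
    curvature of the quadratic part absorb the defect [rho/2 |u - x|^2]
    ([subgradient_cost_min]).  Applied to the threshold operator, it gives at
    [x k.+1] the subgradient [(x k - x k.+1) / alpha + H^T (y - H (x k))].

    Adding the subgradient inequalities at [s] and at [x k.+1] gives
      (1 - alpha (sigma_M + rho) / 2) |x k - x k.+1|^2
        <= (1 - alpha rho) (|x k - s|^2 - |x k.+1 - s|^2)
    ([forward_backward_fejer]).  Both constants are positive because of
    the bound on [alpha] and [rho <= sigma_M].  So the distance to every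
    minimizer decreases and the increments tend to 0.  The sequence is then
    bounded; at a limit of a subsequence the subgradient inequality survives,
    [P] being lower semicontinuous ([subgradient_cvg]), and the increments
    vanish, so that limit is a minimizer.  The distance to it decreases and
    tends to 0 along a subsequence, hence tends to 0 ([fejer_cvg]).

    Two facts on the side come from compactness of Euclidean balls: the
    Rayleigh quotient of a symmetric matrix attains its minimum at an
    eigenvector, which bounds [|H v|^2] between [sigma_m |v|^2] and
    [sigma_M |v|^2]; and a strongly convex lower semicontinuous function has a
    minimizer, so that the threshold operator does return one. *)

(** * The Euclidean inner product *)

Definition dot (R : realType) (n : nat) (u v : 'cV[R]_n) : R := (u^T *m v) 0 0.

Definition sq (R : realType) (n : nat) (u : 'cV[R]_n) : R := dot u u.

Section InnerProduct.
Variables (R : realType) (n : nat).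
Implicit Types (u v w : 'cV[R]_n) (a t : R).

Lemma dotE u v : dot u v = \sum_i u i 0 * v i 0.
Proof. by rewrite /dot mxE; apply: eq_bigr => i _; rewrite mxE. Qed.

Lemma dotC u v : dot u v = dot v u.
Proof. by rewrite !dotE; apply: eq_bigr => i _; rewrite mulrC. Qed.

Lemma dotDl u v w : dot (u + v) w = dot u w + dot v w.
Proof. by rewrite /dot linearD mulmxDl mxE. Qed.

Lemma dotDr u v w : dot w (u + v) = dot w u + dot w v.
Proof. by rewrite ![dot w _]dotC dotDl. Qed.

Lemma dotZl a u w : dot (a *: u) w = a * dot u w.
Proof. by rewrite /dot linearZ -scalemxAl mxE. Qed.

Lemma dotZr a u w : dot w (a *: u) = a * dot w u.
Proof. by rewrite ![dot w _]dotC dotZl. Qed.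

Lemma dotNl u w : dot (- u) w = - dot u w.
Proof. by rewrite -scaleN1r dotZl mulN1r. Qed.

Lemma dotNr u w : dot w (- u) = - dot w u.
Proof. by rewrite ![dot w _]dotC dotNl. Qed.

Definition dotlin := (dotDl, dotDr, dotNl, dotNr, dotZl, dotZr).

Lemma sq_ge0 u : 0 <= sq u.
Proof. by rewrite /sq dotE sumr_ge0// => i _; rewrite -expr2 sqr_ge0. Qed.

Lemma sq0 : sq (0 : 'cV[R]_n) = 0.
Proof. by rewrite /sq /dot mulmx0 mxE. Qed.

Lemma coord_sq_le u i : u i 0 ^+ 2 <= sq u.
Proof.
rewrite /sq dotE (bigD1 i)//= expr2 lerDl.
by rewrite sumr_ge0// => j _; rewrite -expr2 sqr_ge0.
Qed.

Lemma sq_eq0 u : sq u <= 0 -> u = 0.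
Proof.
move=> u0; apply/colP => i; rewrite mxE; apply/eqP; rewrite -sqrf_eq0 eq_le.
by rewrite sqr_ge0 (le_trans (coord_sq_le u i) u0).
Qed.

Lemma sqZ a u : sq (a *: u) = a ^+ 2 * sq u.
Proof. by rewrite /sq !dotlin mulrA. Qed.

Lemma sqN u : sq (- u) = sq u.
Proof. by rewrite /sq !dotlin opprK. Qed.

Lemma sqB u v : sq (u - v) = sq u - 2 * dot u v + sq v.
Proof. by rewrite /sq !dotlin (dotC v u); ring. Qed.

Lemma sqD_le u v : sq (u + v) <= 2 * sq u + 2 * sq v.
Proof.
have := sq_ge0 (u - v); rewrite /sq !dotlin (dotC v u); lra.
Qed.

Lemma norm2_sq u : norm2 u ^+ 2 = sq u.
Proof.
rewrite /norm2 sqr_sqrtr; last by rewrite sumr_ge0// => i _; rewrite sqr_ge0.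
by rewrite /sq dotE; apply: eq_bigr => i _; rewrite expr2.
Qed.

End InnerProduct.

Lemma dot_adjoint (R : realType) (m n : nat) (A : 'M[R]_(m, n))
    (u : 'cV[R]_n) (v : 'cV[R]_m) : dot (A^T *m v) u = dot v (A *m u).
Proof. by rewrite /dot trmx_mul trmxK mulmxA. Qed.

(** Dividing a first-order expansion by its step [t] and letting [t] go to 0,
    in a form that needs no limit: every optimality condition below comes from
    an inequality of this kind. *)
Lemma le0_of_le_mul (R : realType) (X K : R) :
  (forall t, 0 < t -> t < 1 -> X <= t * K) -> X <= 0.
Proof.
move=> XK; rewrite leNgt; apply/negP => X0.
have D0 : 0 < `|K| + X by rewrite ltr_wpDl.
pose t := X / (2 * (`|K| + X)).
have tE : t * (2 * (`|K| + X)) = X by rewrite /t mulfVK// gt_eqF// mulr_gt0.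
have t0 : 0 < t by rewrite /t divr_gt0// mulr_gt0.
have t1 : t < 1.
  by rewrite /t ltr_pdivrMr ?mul1r ?mulr_gt0//; have := normr_ge0 K; lra.
have tK : t * K <= t * `|K| by rewrite ler_wpM2l ?ler_norm ?ltW.
(* Here [X <= t K <= t |K| = X / 2 - t X < X]. *)
have := XK t t0 t1; have := mulr_gt0 t0 X0; lra.
Qed.

(** * Topology of column vectors *)

Section MatrixTopology.
Variables (R : realType).

Lemma cvg_mx_coord (T : Type) (F : set_system T) {FF : Filter F} (m n : nat)
    (f : T -> 'M[R]_(m, n)) (M : 'M[R]_(m, n)) :
  (forall i j, f t i j @[t --> F] --> M i j) -> f t @[t --> F] --> M.
Proof.
move=> fM; apply/cvg_ballP => e e0.
have : \forall t \near F, forall ij : 'I_m * 'I_n,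
    ball (M ij.1 ij.2) e (f t ij.1 ij.2).
  by apply: filter_forall => -[i j]; exact: (cvg_ball (fM i j)).
by apply: filterS => t Mt; split => // i j; exact: (Mt (i, j)).
Qed.

Lemma cvg_coord (T : Type) (F : set_system T) {FF : Filter F} (m n : nat)
    (f : T -> 'M[R]_(m, n)) (M : 'M[R]_(m, n)) i j :
  f t @[t --> F] --> M -> f t i j @[t --> F] --> M i j.
Proof.
move=> fM.
exact: (@cvg_comp _ _ _ f (fun N : 'M[R]_(m, n) => N i j) F _ _ fM
  (@coord_continuous _ _ _ i j M)).
Qed.

Lemma cvg_mulmx (T : Type) (F : set_system T) {FF : Filter F} (m n p : nat)
    (f : T -> 'M[R]_(m, n)) (g : T -> 'M[R]_(n, p))
    (M : 'M[R]_(m, n)) (N : 'M[R]_(n, p)) :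
  f t @[t --> F] --> M -> g t @[t --> F] --> N ->
  (f t *m g t) @[t --> F] --> M *m N.
Proof.
move=> fM gN; apply: cvg_mx_coord => i j; rewrite mxE.
under eq_fun do rewrite mxE.
apply: cvg_big => [|k _]; first exact: add_continuous.
by apply: cvgM; exact: cvg_coord.
Qed.

Lemma cvg_dot (T : Type) (F : set_system T) {FF : Filter F} (n : nat)
    (f g : T -> 'cV[R]_n) (u v : 'cV[R]_n) :
  f t @[t --> F] --> u -> g t @[t --> F] --> v ->
  dot (f t) (g t) @[t --> F] --> dot u v.
Proof.
move=> fu gv; apply: cvg_coord; apply: cvg_mulmx => //.
by apply: cvg_mx_coord => i j; rewrite mxE; under eq_fun do rewrite mxE;
  exact: cvg_coord.
Qed.

Lemma continuous_mulmx (m n : nat) (A : 'M[R]_(m, n)) :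
  continuous (fun u : 'cV[R]_n => A *m u).
Proof.
move=> u; apply: (@cvg_mulmx _ (nbhs u)); [exact: cvg_cst|exact: cvg_id].
Qed.

Lemma continuous_sq (n : nat) : continuous (@sq R n).
Proof. by move=> u; apply: (@cvg_dot _ (nbhs u)); exact: cvg_id. Qed.

(** A bounded set of columns lies in a cube, which is the transpose of a compact
    product of segments. *)
Lemma closed_bounded_compact (n : nat) (A : set 'cV[R]_n) (M : R) :
  closed A -> (forall u, A u -> sq u <= M) -> compact A.
Proof.
move=> clA bA.
(* [c ^+ 2 >= M] whatever [M >= 0] is, so the coordinates are at most [c]. *)
pose c := M + 1.
pose B := [set u : 'rV[R]_n | forall i, `[- c, c]%classic (u ord0 i)].
have cB : compact (trmx @` B).
  apply: continuous_compact; last first.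
    by apply: (@rV_compact R n (fun=> `[- c, c]%classic)) => _;
      exact: segment_compact.
  apply: continuous_subspaceT => u.
  apply: (@cvg_mx_coord _ (nbhs u)) => i j.
  rewrite mxE; under eq_fun do rewrite mxE.
  exact: coord_continuous.
apply: subclosed_compact clA cB _ => u Au; exists u^T; last by rewrite trmxK.
move=> i /=; rewrite mxE in_itv/= -ler_norml.
have M0 := le_trans (sq_ge0 u) (bA u Au).
rewrite -ler_sqr ?nnegrE ?normr_ge0 ?addr_ge0// real_normK ?num_real//.
by rewrite (le_trans (coord_sq_le u i))// (le_trans (bA u Au))// /c; nra.
Qed.

Lemma closed_sqle (n : nat) (M : R) : closed [set u : 'cV[R]_n | sq u <= M].
Proof.
apply: (@closed_comp _ _ (@sq R n) [set r | r <= M]); last exact: closed_le.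
by move=> u _; exact: continuous_sq.
Qed.

Lemma compact_sqle (n : nat) (M : R) : compact [set u : 'cV[R]_n | sq u <= M].
Proof. by apply: (@closed_bounded_compact _ _ M) => //; exact: closed_sqle. Qed.

Lemma cvg_sq0 (T : Type) (F : set_system T) {FF : Filter F} (n : nat)
    (f : T -> 'cV[R]_n) (p : 'cV[R]_n) :
  sq (f t - p) @[t --> F] --> 0 -> f t @[t --> F] --> p.
Proof.
move=> fp; apply: cvg_mx_coord => i j; rewrite (ord1 j).
apply/cvgrPdist_lt => e e0.
have /cvgrPdist_lt/(_ (e ^+ 2))fp2 := fp.
have := fp2 (exprn_gt0 _ e0); apply: filterS => t.
rewrite sub0r normrN ger0_norm ?sq_ge0// => fte.
rewrite distrC -ltr_sqr ?nnegrE ?normr_ge0 ?(ltW e0)//.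
rewrite real_normK ?num_real//.
by apply: le_lt_trans fte; have := coord_sq_le (f t - p) i; rewrite !mxE.
Qed.

Lemma bounded_subseq (n : nat) (x : nat -> 'cV[R]_n) (M : R) :
  (forall k, sq (x k) <= M) ->
  exists (p : 'cV[R]_n) (phi : nat -> nat),
    (forall j, (j < phi j)%N) /\ x (phi j) @[j --> \oo] --> p.
Proof.
move=> xM.
have [|p [_ clp]] := @compact_sqle n M (x @ \oo) _.
  by exists 0%N => // k _; exact: xM.
have /choice[phi phiP] j :
    exists k, (j < k)%N /\ sq (x k - p) < j.+1%:R^-1.
  have [||_ [[k /= jk <-] Vk]] := clp (x @` [set k | (j < k)%N])
      [set u | sq (u - p) < j.+1%:R^-1].
  - by exists j.+1 => // k /= jk; exists k.
  - have : sq (u - p) @[u --> p] --> sq (p - p).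
      by apply: (@cvg_dot _ (nbhs p)); (apply: cvgB; [exact: cvg_id|exact: cvg_cst]).
    rewrite subrr sq0 => /cvgrPdist_lt/(_ j.+1%:R^-1)/= pj.
    have := pj; rewrite invr_gt0 ltr0n => /(_ isT); apply: filterS => u.
    by rewrite sub0r normrN ger0_norm ?sq_ge0.
  - by exists k.
exists p, phi; split=> [j|]; first by have [] := phiP j.
apply: cvg_sq0.
apply: (@squeeze_cvgr _ _ _ _ (fun=> 0) (fun j => harmonic j)).
- by apply: nearW => j; rewrite sq_ge0/=; apply: ltW; case: (phiP j).
- exact: cvg_cst.
- exact: cvg_harmonic.
Qed.

(** The sublevel sets of [f] over [K] generate a filter if no minimum is
    attained, and lower semicontinuity at a cluster point of that filter
    contradicts the existence of a strictly smaller value. *)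
Lemma lsc_compact_min (T : topologicalType) (f : T -> R) (K : set T) :
  lower_semicontinuous (fun x => (f x)%:E) -> compact K -> K !=set0 ->
  exists2 p, K p & forall u, K u -> f p <= f u.
Proof.
move=> lf cK [a0 Ka0]; apply: contrapT => nomin.
have lower a : K a -> exists2 b, K b & f b < f a.
  move=> Ka; apply: contrapT => nb; apply: nomin; exists a => // u Ku.
  by rewrite leNgt; apply/negP => fua; apply: nb; exists u.
pose G := filter_from K (fun a => K `&` [set u | f u <= f a]).
have GG : ProperFilter G.
  apply: filter_from_proper; last by move=> a Ka; exists a; split => /=.
  apply: filter_from_filter; first by exists a0.
  move=> a b Ka Kb; have [ab|/ltW ba] := leP (f a) (f b).
    by exists a => // u [Ku /= ua]; do 2!split => //=; exact: le_trans ab.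
  by exists b => // u [Ku /= ub]; do 2!split => //=; exact: le_trans ba.
have [|p [Kp clp]] := cK G GG; first by exists a0 => // u [].
have [b Kb fbp] := lower p Kp.
have [V pV fV] := lf p (f b) (ltac:(by rewrite lte_fin)).
have [|u [[_ /= fub] /fV]] := clp (K `&` [set u | f u <= f b]) V _ pV.
  by exists b.
by rewrite lte_fin ltNge fub.
Qed.

Lemma lsc_addr (T : topologicalType) (f g : T -> R) :
  lower_semicontinuous (fun x => (f x)%:E) -> continuous g ->
  lower_semicontinuous (fun x => (g x + f x)%:E).
Proof.
move=> lf cg x a; rewrite lte_fin => ax.
pose e := (g x + f x - a) / 2.
have e0 : 0 < e by rewrite divr_gt0// subr_gt0.
have [|V xV fV] := lf x (f x - e); first by rewrite lte_fin; lra.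
have /cvgrPdist_lt/(_ e e0) gV := cg x.
exists (V `&` [set y | `|g x - g y| < e]); first exact: filterI.
move=> y [/fV + /= gy]; rewrite !lte_fin => fy.
have := ltr_normlW gy; rewrite /e in fy *; lra.
Qed.

End MatrixTopology.

(** * Quadratic forms and extreme eigenvalues *)

(** A minimizer [w] of the quadratic form on the unit sphere, with value [l],
    makes [u |-> <u, A u> - l |u|^2] nonnegative and zero at [w]; its derivative
    at [w] then vanishes, so [w] is an eigenvector for [l], and [s <= l]. *)
Lemma least_eigenvalue_quadratic (R : realType) (n : nat) (A : 'M[R]_n)
    (s : R) (v : 'cV[R]_n) :
  A^T = A -> (forall a, eigenvalue A a -> s <= a) -> s * sq v <= dot v (A *m v).
Proof.
move=> symA le_s.
have [->|v0] := eqVneq v 0; first by rewrite mulmx0 sq0 mulr0 /dot mulmx0 mxE.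
have sq_gt0 (u : 'cV[R]_n) : u != 0 -> 0 < sq u.
  by move=> u0; rewrite ltNge; apply: contra u0 => /sq_eq0 ->.
pose S := [set u : 'cV[R]_n | sq u = 1].
have normalS (u : 'cV[R]_n) : u != 0 -> S ((Num.sqrt (sq u))^-1 *: u).
  move=> u0; rewrite /S/= sqZ exprVn sqr_sqrtr ?sq_ge0// mulVf//.
  by rewrite gt_eqF ?sq_gt0.
have clS : closed S.
  apply: (@closed_comp _ _ (@sq R n) [set r | r = 1]); last exact: closed_eq.
  by move=> u _; exact: continuous_sq.
have cQ : continuous (fun u : 'cV[R]_n => dot u (A *m u)).
  move=> u; apply: (@cvg_dot _ _ (nbhs u)); first exact: cvg_id.
  exact: continuous_mulmx.
have [||w /[!inE] w1 wmin] :=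
    @compact_EVT_min _ R (fun u : 'cV[R]_n => dot u (A *m u)) S _ _
      (continuous_subspaceT cQ).
- by eexists; exact: normalS v0.
- by apply: (@closed_bounded_compact _ _ _ 1) => // u ->.
set l := dot w (A *m w) in wmin.
have lQ u : l * sq u <= dot u (A *m u).
  have [->|u0] := eqVneq u 0; first by rewrite mulmx0 sq0 mulr0 /dot mulmx0 mxE.
  have := wmin _ (mem_set (normalS u u0)).
  rewrite -scalemxAr !dotlin mulrA -expr2 exprVn sqr_sqrtr ?sq_ge0//.
  by rewrite [_^-1 * _]mulrC ler_pdivlMr ?sq_gt0.
have [z zD] : exists z, z = A *m w - l *: w by eexists.
have z0 : z = 0.
  (* Perturbing [w] in the direction [- z], with [z] half the gradient at [w],
     would make the form negative to first order. *)
  apply: sq_eq0; suff : 2 * sq z <= 0 by lra.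
  apply: (@le0_of_le_mul R _ (dot z (A *m z) - l * sq z)) => t t0 t1.
  have := lQ (w - t *: z).
  have Awz : dot w (A *m z) = dot z (A *m w).
    by rewrite -dot_adjoint symA dotC.
  have zE : sq z = dot z (A *m w) - l * dot z w.
    by rewrite /sq {2}zD !dotlin.
  have lE : dot w (A *m w) = l by [].
  rewrite mulmxBr -scalemxAr {1}/sq !dotlin Awz -!/(sq _) w1 lE (dotC w z) => h.
  have : t * (2 * sq z) <= t * (t * (dot z (A *m z) - l * sq z)).
by rewrite {1}zE; lra.
  by rewrite ler_pM2l.
have evl : eigenvalue A l.
  apply/eigenvalueP; exists w^T.
    by rewrite -[A in LHS]symA -trmx_mul -linearZ/=; congr _^T;
      apply/eqP; rewrite -subr_eq0 -zD z0.
  apply/eqP => /(congr1 trmx); rewrite trmxK trmx0 => w0.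
  by have /eqP : sq w = 1 := w1; rewrite w0 sq0 eq_sym oner_eq0.
by apply: le_trans (lQ v); rewrite ler_wpM2r ?sq_ge0// le_s.
Qed.

Lemma greatest_eigenvalue_quadratic (R : realType) (n : nat) (A : 'M[R]_n)
    (s : R) (v : 'cV[R]_n) :
  A^T = A -> (forall a, eigenvalue A a -> a <= s) -> dot v (A *m v) <= s * sq v.
Proof.
move=> symA le_s.
rewrite -lerN2 -mulNr -dotNr -mulNmx.
apply: least_eigenvalue_quadratic; first by rewrite linearN/= symA.
move=> a /eigenvalueP[w wA w0]; rewrite lerNl; apply: le_s.
by apply/eigenvalueP; exists w => //; rewrite scaleNr -wA mulmxN opprK.
Qed.

(** * Weak convexity and its subgradients *)

Section WeakConvexity.
Variables (R : realType) (n : nat).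
Implicit Types (f P : 'cV[R]_n -> R) (x u v g : 'cV[R]_n) (rho c t : R).

(** Convexity of [rho/2 |.|^2 + f], with the quadratic part moved to the right
    side.  The parameter may be negative, which is strong convexity, so that
    adding a quadratic only shifts it. *)
Definition semiconvex rho f : Prop :=
  forall u v t, 0 <= t -> t <= 1 ->
    f (t *: u + (1 - t) *: v) <=
    t * f u + (1 - t) * f v + rho / 2 * (t * (1 - t)) * sq (u - v).

(** The proximal subgradients of [f] at [x], with their curvature constant. *)
Definition subgradient rho f x g : Prop :=
  forall u, f x + dot g (u - x) - rho / 2 * sq (u - x) <= f u.

Lemma weakly_convex_semiconvex rho f : weakly_convex rho f -> semiconvex rho f.
Proof.
move=> fcvx u v t t0 t1.
have := fcvx rho (lexx _) (Itv01 t0 t1) u v (in_setT _) (in_setT _).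
rewrite convRE !norm2_sq.
rewrite [conv _ _ _](_ : _ = t *: u + (1 - t) *: v)//=.
rewrite /unstable.onem /sq !dotlin (dotC v u); lra.
Qed.

Lemma semiconvex_prox rho c f (b : 'cV[R]_n) :
  semiconvex rho f -> semiconvex (rho - 2 * c) (fun u => c * sq (b - u) + f u).
Proof.
move=> fcvx u v t t0 t1; have := fcvx u v t t0 t1.
rewrite /sq !dotlin (dotC v u) (dotC u b) (dotC v b); lra.
Qed.

(** On the unit ball [f] is bounded below by [f p].  Strong convexity along the
    ray from 0 through [u] bounds [f u] below by a quadratic in [|u|] whose
    linear coefficient depends on [f 0 - f p]; hence [f u >= f 0] once [|u|]
    exceeds [r], and a minimizer over the ball of radius [r] is a global one. *)
Lemma strongly_convex_min rho f :
  rho < 0 -> semiconvex rho f -> lower_semicontinuous (fun x => (f x)%:E) ->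
  minimizers f !=set0.
Proof.
move=> rho_lt0 fcvx lf.
have K0 M : 0 <= M -> [set u : 'cV[R]_n | sq u <= M] !=set0.
  by move=> M0; exists 0; rewrite /= sq0.
have [p _ fp] := lsc_compact_min lf (@compact_sqle R n 1) (K0 1 ler01).
pose k := - rho / 2.
have k0 : 0 < k by rewrite /k; lra.
have fp0 : f p <= f 0 by apply: fp; rewrite /= sq0.
pose r := 1 + (f 0 - f p) / k.
have [q _ fq] := lsc_compact_min lf (@compact_sqle R n (r ^+ 2))
  (K0 _ (sqr_ge0 r)).
exists q => u; have [ur|ru] := leP (sq u) (r ^+ 2); first exact: fq.
have r1 : 1 <= r by rewrite /r lerDl divr_ge0 ?subr_ge0// ltW.
apply: le_trans (_ : f 0 <= f u); first by apply: fq; rewrite /= sq0 sqr_ge0.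
set s := Num.sqrt (sq u).
have s2 : s ^+ 2 = sq u by rewrite sqr_sqrtr ?sq_ge0.
have rs : r < s by rewrite -ltr_sqr ?nnegrE ?sqrtr_ge0 ?s2//; lra.
have s0 : 0 < s by lra.
have is0 : 0 < s^-1 by rewrite invr_gt0.
have is1 : s^-1 <= 1 by rewrite invf_le1//; lra.
(* Convexity between 0, [u] and the point of norm 1 on the segment. *)
have := fcvx u 0 s^-1 (ltW is0) is1.
rewrite scaler0 addr0 subr0.
have := fp (s^-1 *: u); rewrite /= sqZ exprVn s2 mulVf; last first.
  by rewrite -s2 sqrf_eq0 gt_eqF.
move=> /(_ (lexx _)) h1 h2.
have sV : s * s^-1 = 1 by rewrite mulfV// gt_eqF.
have h3 := le_trans h1 h2.
have h4 : s * f p <= f u + (s - 1) * f 0 - k * (s * (s - 1)).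
  have := ler_wpM2l (ltW s0) h3; rewrite -s2 /k.
  have -> : s * (s^-1 * f u + (1 - s^-1) * f 0 +
      rho / 2 * (s^-1 * (1 - s^-1)) * s ^+ 2) =
    (s * s^-1) * f u + (s - s * s^-1) * f 0 +
      rho / 2 * ((s * s^-1) * (s * (s - s * s^-1))) by ring.
  rewrite sV; lra.
have h5 : f 0 - f p <= k * (s - 1).
  have : k * (r - 1) = f 0 - f p by rewrite /r addrAC subrr add0r mulrCA mulfV
    ?mulr1// gt_eqF.
  have : k * r <= k * s by rewrite ler_wpM2l// ltW.
  lra.
have := ler_wpM2l (ltW s0) h5; lra.
Qed.

(** The subgradient is minus the gradient of the quadratic part: compare [x] with
    the points of the segment towards [u] and let them tend to [x]. *)
Lemma argmin_subgradient (m : nat) rho c P (b : 'cV[R]_m) (A : 'M[R]_(m, n)) x :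
  semiconvex rho P -> minimizers (fun u => c * sq (b - A *m u) + P u) x ->
  subgradient rho P x ((2 * c) *: (A^T *m (b - A *m x))).
Proof.
move=> Pcvx xmin u.
set e := b - A *m x; set h := A *m (u - x).
rewrite -subr_le0 dotZl dot_adjoint -/e -/h.
apply: (@le0_of_le_mul R _ (c * sq h - rho / 2 * sq (u - x))) => t t0 t1.
have xt := Pcvx u x t (ltW t0) (ltW t1).
have /= := xmin (t *: u + (1 - t) *: x); rewrite -/e.
have -> : b - A *m (t *: u + (1 - t) *: x) = e - t *: h.
  rewrite /e /h mulmxDr -!scalemxAr mulmxBr scalerBl scale1r scalerBr.
  by rewrite -addrA -opprD; congr (b - _); rewrite addrCA [RHS]addrC addrC -addrA.
clearbody e h; rewrite (sqB e) sqZ dotZr.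
move=> hmin; rewrite -(ler_pM2l t0); lra.
Qed.

(** Only a lower bound of [P (w i)] by [P x] is needed in the limit, hence
    lower semicontinuity suffices. *)
Lemma subgradient_cvg (T : Type) (F : set_system T) {FF : ProperFilter F}
    rho P (w g : T -> 'cV[R]_n) (x gx : 'cV[R]_n) :
  lower_semicontinuous (fun x => (P x)%:E) ->
  (forall i, subgradient rho P (w i) (g i)) ->
  w i @[i --> F] --> x -> g i @[i --> F] --> gx -> subgradient rho P x gx.
Proof.
move=> lP wg wx ggx u.
pose q (w g : 'cV[R]_n) := dot g (u - w) - rho / 2 * sq (u - w).
have qcvg : q (w i) (g i) @[i --> F] --> q x gx.
  have uw : u - w i @[i --> F] --> u - x by apply: cvgB => //; exact: cvg_cst.
  apply: cvgB; first exact: cvg_dot.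
  by apply: cvgM; [exact: cvg_cst|exact: cvg_dot].
rewrite -addrA -/(q x gx); apply/ler_addgt0Pr => e e0.
have e20 : 0 < e / 2 by rewrite divr_gt0.
have [|V xV PV] := lP x (P x - e / 2); first by rewrite lte_fin; lra.
have Vw : \forall i \near F, V (w i) by exact: wx.
have /cvgrPdist_lt/(_ _ e20) qe := qcvg.
have [i [/PV + qt]] := @filter_ex _ F _ _ (filterI Vw qe).
rewrite lte_fin => Pt; have := wg i u; rewrite -addrA -/(q (w i) (g i)).
have := ltr_normlW qt; lra.
Qed.

Section LeastSquares.
Variables (m : nat) (y : 'cV[R]_m) (H : 'M[R]_(m, n)) (P : 'cV[R]_n -> R).
Variables (rho : R) (rho_le : forall v : 'cV[R]_n, rho * sq v <= sq (H *m v)).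

Lemma cost_min_subgradient x :
  semiconvex rho P -> minimizers (cost y H P) x ->
  subgradient rho P x (H^T *m (y - H *m x)).
Proof.
move=> Pcvx xmin.
have := @argmin_subgradient m rho (1 / 2) P y H x Pcvx.
rewrite mulrCA mulfV// mulr1 scale1r; apply => u.
by have := xmin u; rewrite /cost !norm2_sq.
Qed.

(** The quadratic part exceeds its linearization at [x] by [|H (u - x)|^2 / 2],
    which makes up for the defect [rho/2 |u - x|^2] of the subgradient. *)
Lemma subgradient_cost_min x :
  subgradient rho P x (H^T *m (y - H *m x)) -> minimizers (cost y H P) x.
Proof.
move=> xg u; rewrite /cost !norm2_sq.
have := xg u; rewrite dot_adjoint.
have -> : y - H *m u = (y - H *m x) - H *m (u - x).
  by rewrite mulmxBr opprB addrA subrK.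
have := rho_le (u - x).
rewrite (sqB (y - _)); lra.
Qed.

(** With [d = x - s] and [e = x' - s], adding the two subgradient inequalities
    gives [<d - e, e> - alpha <H d, H e> >= - alpha rho |e|^2].  The cross term is
    bounded by polarization,
      4 <H d, H e> = |H (d + e)|^2 - |H (d - e)|^2
                   >= rho |d + e|^2 - sigma |d - e|^2,
    and the rest is the parallelogram identity. *)
Lemma forward_backward_fejer sigma alpha s x x' :
  (forall v : 'cV[R]_n, sq (H *m v) <= sigma * sq v) -> 0 < alpha ->
  subgradient rho P s (H^T *m (y - H *m s)) ->
  subgradient rho P x' (alpha^-1 *: (x - x') + H^T *m (y - H *m x)) ->
  (1 - alpha * (sigma + rho) / 2) * sq (x - x') <=
  (1 - alpha * rho) * (sq (x - s) - sq (x' - s)).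
Proof.
move=> le_sigma alpha0 /(_ x') gs /(_ s) gx.
set d := x - s; set e := x' - s.
have xx' : x - x' = d - e by rewrite /d /e opprB addrA subrK.
have low := rho_le (d + e); have up := le_sigma (d - e).
have g0 : - (rho * sq e) <= alpha^-1 * dot (d - e) e - dot (H *m d) (H *m e).
  have yHx : y - H *m x = (y - H *m s) - H *m d.
    by rewrite /d mulmxBr opprB addrA subrK.
  move: gs gx; rewrite -[s - x']opprB -/e xx' yHx.
  move: (y - H *m s) => f; clearbody d e.
  by rewrite sqN dotNr !dotDl dotZl !dot_adjoint !dotDl !dotNl; lra.
have aV : alpha * alpha^-1 = 1 by rewrite mulfV// gt_eqF.
have g1 : - (alpha * rho * sq e) <=
    dot (d - e) e - alpha * dot (H *m d) (H *m e).
  have := ler_wpM2l (ltW alpha0) g0.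
  rewrite mulrBr mulrA aV mul1r; lra.
rewrite xx'; clearbody d e.
have {}low := ler_wpM2l (ltW alpha0) low; have {}up := ler_wpM2l (ltW alpha0) up.
move: low up g1; rewrite mulmxBr mulmxDr /sq !dotlin (dotC e d).
rewrite (dotC (H *m e) (H *m d)); lra.
Qed.

End LeastSquares.

(** The condition [alpha rho < 1] makes the proximal problem strongly convex, so
    a minimizer exists and the default value of [threshold] is not used. *)
Lemma threshold_subgradient rho alpha P z :
  semiconvex rho P -> lower_semicontinuous (fun x => (P x)%:E) ->
  0 < alpha -> alpha * rho < 1 ->
  subgradient rho P (threshold alpha P z)
    (alpha^-1 *: (z - threshold alpha P z)).
Proof.
move=> Pcvx lP alpha0 arho.
pose c := 1 / (2 * alpha).
have cE : 2 * c = alpha^-1 by rewrite /c; field; rewrite gt_eqF.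
pose f u := c * sq (z - 1%:M *m u) + P u.
have fE : (fun x => 1 / (2 * alpha) * norm2 (x - z) ^+ 2 + P x) = f.
  by apply/funext => u; rewrite /f norm2_sq -sqN opprB mul1mx.
have [w wmin] : minimizers f !=set0.
  have -> : f = (fun u => c * sq (z - u) + P u).
    by apply/funext => u; rewrite /f mul1mx.
  apply: (@strongly_convex_min (rho - 2 * c)).
  - by rewrite subr_lt0 cE -[_^-1]mul1r ltr_pdivlMr// mulrC.
  - exact: semiconvex_prox.
  - apply: lsc_addr => // u.
    apply: (@continuousM R _ (fun=> c) (fun v => sq (z - v))).
      exact: cst_continuous.
    have zu : z - v @[v --> u] --> z - u.
      by apply: (cvgB (F := nbhs u)); [exact: cvg_cst|exact: cvg_id].
    exact: (@cvg_dot _ _ (nbhs u)).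
have tmin : minimizers f (threshold alpha P z).
  by rewrite /threshold fE; exact: xgetPex (ex_intro _ w wmin).
have := argmin_subgradient Pcvx tmin.
by rewrite trmx1 !mul1mx cE.
Qed.

End WeakConvexity.

(** * Fejér monotone sequences and convergence *)

(** The argument of Opial: boundedness gives a subsequential limit [p], which
    lies in [S], and the decreasing sequence of distances to [p] tends to 0 along
    the subsequence. *)
Lemma fejer_cvg (R : realType) (n : nat) (x : nat -> 'cV[R]_n)
    (S : set 'cV[R]_n) :
  S !=set0 -> (forall s k, S s -> sq (x k.+1 - s) <= sq (x k - s)) ->
  (forall (p : 'cV[R]_n) (phi : nat -> nat), (forall j, (j < phi j)%N) ->
    x (phi j) @[j --> \oo] --> p -> S p) ->
  exists2 s, S s & x @ \oo --> s.
Proof.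
move=> [s0 Ss0] fejer clS.
have decr s : S s -> {homo (fun k => sq (x k - s)) : k l / (k <= l)%N >-> l <= k}.
  by move=> Ss; apply/nonincreasing_seqP => k; exact: fejer.
have bx k : sq (x k) <= 2 * sq (x 0%N - s0) + 2 * sq s0.
  by rewrite -(subrK s0 (x k)); apply: le_trans (sqD_le _ _) _;
    rewrite lerD2r ler_pM2l//; exact: decr.
have [p [phi [phi_gt xphi]]] := bounded_subseq bx.
have Sp := clS p phi phi_gt xphi.
exists p => //; apply: cvg_sq0; apply/cvgrPdist_lt => e e0.
have : sq (x (phi j) - p) @[j --> \oo] --> sq (p - p).
  have xp : x (phi j) - p @[j --> \oo] --> p - p.
    by apply: cvgB => //; exact: cvg_cst.
  exact: cvg_dot.
rewrite subrr sq0 => /cvgrPdist_lt/(_ e e0)[N _ /(_ N (leqnn N))] /=.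
rewrite sub0r normrN ger0_norm ?sq_ge0// => xNe.
exists (phi N) => // k /= Nk; rewrite sub0r normrN ger0_norm ?sq_ge0//.
by apply: le_lt_trans xNe; exact: decr.
Qed.

Lemma nonincreasing_diff_cvg0 (R : realType) (a : nat -> R) :
  (forall k, 0 <= a k) -> (forall k, a k.+1 <= a k) ->
  a k - a k.+1 @[k --> \oo] --> 0.
Proof.
move=> a0 aS.
have ca : cvgn a.
  apply: nonincreasing_is_cvgn; first exact/nonincreasing_seqP.
  by exists 0 => _ [k _ <-].
rewrite -(subrr (limn a)); apply: cvgB => //.
by have := ca; rewrite -(cvg_shiftS a).
Qed.

(* The bound 2 / (sigma_M + rho) is read as +oo when sigma_M + rho = 0. *)
Theorem proposition4 (R : realType) (m n : nat) (y : 'cV[R]_m)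
    (H : 'M[R]_(m, n)) (sigma_m sigma_M : R)
    (sigma_mP : least_eigenvalue (H^T *m H) sigma_m)
    (sigma_MP : greatest_eigenvalue (H^T *m H) sigma_M)
    (P : 'cV[R]_n -> R) (rho : R)
    (P_lsc : lower_semicontinuous (fun x => (P x)%:E))
    (P_wcvx : weakly_convex rho P)
    (rho_ge0 : 0 <= rho) (rho_le : rho <= sigma_m)
    (C_min : minimizers (cost y H P) !=set0)
    (alpha : R) (alpha_gt0 : 0 < alpha)
    (alpha_lt : sigma_M + rho != 0 -> alpha < 2 / (sigma_M + rho))
    (x : nat -> 'cV[R]_n)
    (x_rec : forall k : nat,
       x k.+1 = threshold alpha P (x k + alpha *: (H^T *m (y - H *m x k)))) :
  exists2 xs : 'cV[R]_n, minimizers (cost y H P) xs & x @ \oo --> xs.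
Proof.
have Pcvx := weakly_convex_semiconvex P_wcvx.
have symB : (H^T *m H)^T = H^T *m H by rewrite trmx_mul trmxK.
have sqH (v : 'cV[R]_n) : dot v (H^T *m H *m v) = sq (H *m v).
  by rewrite -mulmxA dotC dot_adjoint.
have rhoH (v : 'cV[R]_n) : rho * sq v <= sq (H *m v).
  rewrite -sqH; apply: least_eigenvalue_quadratic => // a.
  by move/(proj2 sigma_mP); exact: le_trans.
have sigmaH (v : 'cV[R]_n) : sq (H *m v) <= sigma_M * sq v.
  rewrite -sqH; apply: greatest_eigenvalue_quadratic => //.
  exact: (proj2 sigma_MP).
have rho_sigma : rho <= sigma_M.
  by apply: le_trans rho_le _; apply: (proj2 sigma_MP); case: sigma_mP.
have step : alpha * (sigma_M + rho) < 2.
  have [->|nz] := eqVneq (sigma_M + rho) 0; first by rewrite mulr0.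
  rewrite -ltr_pdivlMr ?alpha_lt// lt_neqAle eq_sym nz; lra.
have arho : alpha * rho < 1.
  have : alpha * rho <= alpha * sigma_M by rewrite ler_wpM2l// ltW.
  lra.
pose G u := H^T *m (y - H *m u).
have subg k : subgradient rho P (x k.+1) (alpha^-1 *: (x k - x k.+1) + G (x k)).
  have := threshold_subgradient (x k + alpha *: G (x k)) Pcvx P_lsc alpha_gt0 arho.
  rewrite -x_rec addrAC scalerDr scalerA mulVf ?scale1r//.
  by rewrite gt_eqF.
have fejer s k : minimizers (cost y H P) s ->
    (1 - alpha * (sigma_M + rho) / 2) * sq (x k - x k.+1) <=
    (1 - alpha * rho) * (sq (x k - s) - sq (x k.+1 - s)).
  move=> smin; apply: (forward_backward_fejer rhoH sigmaH alpha_gt0).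
    exact: (cost_min_subgradient Pcvx smin).
  exact: subg.
have c0 : 0 < 1 - alpha * rho by lra.
have k0 : 0 < 1 - alpha * (sigma_M + rho) / 2 by lra.
have mono s k : minimizers (cost y H P) s -> sq (x k.+1 - s) <= sq (x k - s).
  move=> smin; rewrite -subr_ge0 -(pmulr_rge0 _ c0).
  by apply: le_trans (fejer s k smin); rewrite mulr_ge0 ?sq_ge0// ltW.
apply: fejer_cvg => // p phi phi_gt xp.
(* The increments are controlled by the decrease of the squared distances to
   one fixed minimizer, which converge. *)
have [s smin] := C_min.
have diff0 : x k - x k.+1 @[k --> \oo] --> (0 : 'cV[R]_n).
  apply: cvg_sq0.
  pose b k := (1 - alpha * rho) / (1 - alpha * (sigma_M + rho) / 2) *
    (sq (x k - s) - sq (x k.+1 - s)).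
  apply: (@squeeze_cvgr _ _ _ _ (fun=> 0) b).
  - apply: nearW => k; rewrite subr0 sq_ge0/= /b mulrAC ler_pdivlMr//.
    by rewrite mulrC fejer.
  - exact: cvg_cst.
  - rewrite -(mulr0 ((1 - alpha * rho) / (1 - alpha * (sigma_M + rho) / 2))).
    apply: cvgM; first exact: cvg_cst.
    apply: nonincreasing_diff_cvg0 => k; [exact: sq_ge0|exact: mono].
(* The subgradient at [x (phi j)] involves the preceding iterate, whose index is
   [(phi j).-1] because [phi j] is positive. *)
have phi_pred : (phi j).-1 @[j --> \oo] --> \oo.
  move=> A [N _ NA]; exists N => // j /= Nj; apply: NA => /=.
  by rewrite (leq_trans Nj)// -ltnS prednK// (leq_trans _ (phi_gt j)).
have phiS j : (phi j).-1.+1 = phi j by rewrite prednK// (leq_trans _ (phi_gt j)).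
have diff_phi : x (phi j).-1 - x (phi j) @[j --> \oo] --> (0 : 'cV[R]_n).
  rewrite [fun j => _](_ : _ =
    (fun k => x k - x k.+1) \o (fun j => (phi j).-1)).
    exact: cvg_comp phi_pred diff0.
  by apply/funext => j /=; rewrite phiS.
have x_pred : x (phi j).-1 @[j --> \oo] --> p.
  rewrite -[p]add0r.
  under eq_fun => j do rewrite -(subrK (x (phi j)) (x (phi j).-1)).
  exact: cvgD.
apply: (subgradient_cost_min rhoH).
apply: (@subgradient_cvg R n nat \oo _ rho P (fun j => x (phi j))
  (fun j => alpha^-1 *: (x (phi j).-1 - x (phi j)) + G (x (phi j).-1))) => //.
  by move=> j; have := subg (phi j).-1; rewrite phiS.
rewrite -[H^T *m _]add0r -(scaler0 _ alpha^-1).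
apply: cvgD; first by apply: cvgZr.
apply: cvg_mulmx; first exact: cvg_cst.
apply: cvgB; first exact: cvg_cst.
by apply: cvg_mulmx => //; exact: cvg_cst.
Qed.
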